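(* Let $A(x)=\sum_{i=0}^nA_ix^i\in\mathcal P_{m,n}$ and $a(x)=\det A(x)$. Let $h_0<h_1<\dots<h_p$ be the values of $\kappa\in\{0,\dots,n\}$ such that $\det A_\kappa\ne0$ and there exist positive real solution(s) of $$x^\kappa=\sum_{i=0,\,i\ne\kappa}^n\|A_\kappa^{-1}A_i\|\,x^i .$$ With $s_{h_i},t_{h_i}$ denoting these solutions as described in the context: \begin{enumerate} \item $t_{h_{i-1}}\le s_{h_i}$ for $i=1,\dots,p$; \item there are $m(h_i-h_{i-1})$ roots of $a(x)$ in the annulus $\mathcal A(t_{h_{i-1}},s_{h_i})$, for $i=1,\dots,p$; \item there are no roots of $a(x)$ in the inner part of the annulus $\mathcal A(s_{h_i},t_{h_i})$, for $i=0,1,\dots,p$. \end{enumerate}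
   Context: $\mathcal P_{m,n}$ is the class of matrix polynomials $A(x)=\sum_{i=0}^nA_ix^i$ with $A_i\in\mathbb C^{m\times m}$ such that $\det A(x)$ is not identically zero, $A_n\ne0$ and $A_0\neq 0$. $\|M\|=\rho(M^*M)^{1/2}$ is the spectral norm. For $0<\kappa<n$ with $\det A_\kappa\neq0$ the displayed equation has, counting multiplicity, either no positive solution or two positive solutions, denoted $s_\kappa\le t_\kappa$. If $\det A_0\ne0$, then for $\kappa=0$ it has a single positive solution $t_0$, and one sets $s_0:=0$. If $\det A_n\neq0$, then for $\kappa=n$ it has a single positive solution $s_n$, and one sets $t_n:=\infty$. Thus $h_0=0$ exactly when $\det A_0\ne0$ and $h_p=n$ exactly when $\det A_n\neq 0$. $\mathcal A(a,b)=\{x\in\mathbb C: a\le|x|\le b\}$; its inner part is $\{x: a<|x|<b\}$. Roots are counted with multiplicity.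
   Formalization: Item 2 fails for a root on a circle |x|=s_κ=t_κ of a double solution (x²−2x+1): it is given as at least m(h_i−h_{i−1}) roots in the closed annulus, and exactly that many if, for κ=h_{i−1},h_i, no root has modulus s_κ when s_κ=t_κ. *)

(* Defs.v *)
From HB Require Import structures.
From mathcomp Require Import all_boot all_order all_algebra.
From mathcomp Require Import all_classical all_reals.
From mathcomp Require Export complex.

Set Implicit Arguments.
Unset Strict Implicit.
Unset Printing Implicit Defensive.

Import Order.TTheory GRing.Theory Num.Theory.
Local Open Scope classical_set_scope.
Local Open Scope ring_scope.
Local Open Scope sesquilinear_scope.

(* The modulus of a complex number as an element of R: `|z| would be an
   element of R[i]. *)
Definition modulus (R : realType) (z : R[i]) : R := ComplexField.Normc.normc z.

Definition spectral_radius (R : realType) (m : nat) (M : 'M[R[i]]_m) : R :=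
  sup [set modulus l | l in [set l : R[i] | eigenvalue M l]].

Definition spectral_norm (R : realType) (m : nat) (M : 'M[R[i]]_m) : R :=
  Num.sqrt (spectral_radius (M ^t* *m M)).

(* A matrix polynomial sum_(i <= n) A_i x^i is given by its n + 1 coefficients;
   ord0 and ord_max are the indices 0 and n. *)
Definition matpoly_det (R : realType) (m n : nat)
    (A : 'I_n.+1 -> 'M[R[i]]_m) : {poly R[i]} :=
  \det (\sum_(i < n.+1) 'X^i *: map_mx polyC (A i)).

Definition in_Pmn (R : realType) (m n : nat)
    (A : 'I_n.+1 -> 'M[R[i]]_m) : Prop :=
  [/\ matpoly_det A != 0, A ord_max != 0 & A ord0 != 0].

Definition pellet_solutions (R : realType) (m n : nat)
    (A : 'I_n.+1 -> 'M[R[i]]_m) (k : 'I_n.+1) : set R :=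
  [set x : R | 0 < x /\
    x ^+ k =
      \sum_(i < n.+1 | i != k) spectral_norm (invmx (A k) *m A i) * x ^+ i].

Definition pellet_index (R : realType) (m n : nat)
    (A : 'I_n.+1 -> 'M[R[i]]_m) (k : 'I_n.+1) : Prop :=
  \det (A k) != 0 /\ exists x : R, pellet_solutions A k x.

(* For 0 < k < n a nonempty set of solutions consists of two numbers
   s_k <= t_k (a single number s_k = t_k if the solution is double), so inf and
   sup return the smaller and the larger one.  For k = 0 and k = n there is a
   single solution, which is t_0 and s_n respectively. *)
Definition pellet_s (R : realType) (m n : nat)
    (A : 'I_n.+1 -> 'M[R[i]]_m) (k : 'I_n.+1) : \bar R :=
  if k == ord0 then 0%:E else (inf (pellet_solutions A k))%:E.

Definition pellet_t (R : realType) (m n : nat)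
    (A : 'I_n.+1 -> 'M[R[i]]_m) (k : 'I_n.+1) : \bar R :=
  if k == ord_max then +oo%E else (sup (pellet_solutions A k))%:E.

Definition annulus (R : realType) (a b : \bar R) : pred R[i] :=
  [pred z | (a <= (modulus z)%:E <= b)%E].

Definition annulus_inner (R : realType) (a b : \bar R) : pred R[i] :=
  [pred z | (a < (modulus z)%:E < b)%E].

(* The factorization p = lead_coef p *: \prod_(z <- r) ('X - z%:P) given by
   closed_field_poly_normal lists in r every root of a nonzero p as many times
   as its multiplicity. *)
Definition nroots_in (R : realType) (p : {poly R[i]}) (D : pred R[i]) : nat :=
  count D (sval (closed_field_poly_normal p)).

(* Main.v *)
Require Import Defs.
From mathcomp Require Import all_boot all_order all_algebra.
From mathcomp Require Import all_classical all_reals.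
From mathcomp Require Import ring lra.

Set Implicit Arguments.
Unset Strict Implicit.
Unset Printing Implicit Defensive.

Import Order.TTheory GRing.Theory Num.Theory.
Local Open Scope ring_scope.
Local Open Scope complex_scope.
Local Open Scope sesquilinear_scope.

(** Let a(x) = det A(x), and let g_k(r) denote the right-hand side of the
equation for index k at radius r, so that its solutions are the r > 0 with r^k
= g_k(r).

Root-free radii: if a(z) = 0, then A(z) v = 0 for some v <> 0. Multiplying by
A_k^-1 and taking norms gives |z|^k <= g_k(|z|). As r |-> g_k(r) / r^k is
convex (monotone if k = 0 or k = n) and equals 1 at the solutions, it is
smaller than 1 strictly between s_k and t_k, where a therefore has no root
([pellet_root_free]).

Order of the solutions: if x solves the equation for j, and y the one for k >
j, then x^(k - j) <= ||A_k^-1 A_j|| <= y^(k - j), because the spectral norms of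
the mutually inverse matrices A_k^-1 A_j and A_j^-1 A_k have a product of at
least 1 ([pellet_solutions_le]).

Root counts: if g_k(r) <= r^k, then a has at most m k roots in the open disc of
radius r, and at least m k in the closed disc ([pellet_count]). Indeed the
polynomials det (A_k x^k + t (A(x) - A_k x^k)), for 0 <= t < 1, have no root of
modulus r, so they all have as many roots in the disc as the one for t = 0,
which is det (A_k) x^(m k); the bounds are what remains of this in the limit t
= 1. At r = t_j and r = s_k, for consecutive indices j < k, this gives at least
m (k - j) roots in the annulus. If s_k < t_k, or if no root has modulus s_k =
t_k, the reverse bounds hold too, since then the closed disc of radius s_k has
no more roots than the open disc of radius t_k.

The stability of the number of roots is Hurwitz' theorem, for which complex
integration is avoided. By Jensen's formula, the Mahler measure M(p, x) = |lead
p| * prod_z max(x, |z|), the product being over the roots z of p, is determined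
by |p| on the circle |w| = x. The product of |p(w)| over N equidistributed w on
the circle is |lead p|^N * prod_z |z^N - x^N|, so letting N tend to infinity
shows that |p| <= B |q| on the circle implies M(p, x) <= B M(q, x)
([mahler_le]). The growth of M(p, x) between two radii counts the roots of p:
M(p, y) / M(p, x) = (y / x)^c if c roots lie inside the smaller circle and none
between them. Hence polynomials which are close on both circles have equally
many roots inside ([count_roots_le], [hurwitz]). *)

(** * The modulus *)

Lemma modulusM (R : realType) (x y : R[i]) :
  modulus (x * y) = modulus x * modulus y.
Proof. exact: ComplexField.Normc.normcM. Qed.

Lemma modulus_normE (R : realType) (z : R[i]) : `|z| = (modulus z)%:C.
Proof. by case: z. Qed.

Lemma modulus_ge0 (R : realType) (z : R[i]) : 0 <= modulus z.
Proof. by rewrite -lecR -modulus_normE normr_ge0. Qed.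

Lemma modulus_eq0 (R : realType) (z : R[i]) : (modulus z == 0) = (z == 0).
Proof.
by rewrite -[RHS]normr_eq0 modulus_normE -(inj_eq (@complexI R)).
Qed.

Lemma modulus_gt0 (R : realType) (z : R[i]) : (0 < modulus z) = (z != 0).
Proof. by rewrite lt_def modulus_ge0 andbT modulus_eq0. Qed.

Lemma modulus0 (R : realType) : modulus (0 : R[i]) = 0.
Proof. by apply/eqP; rewrite modulus_eq0. Qed.

Lemma modulus1 (R : realType) : modulus (1 : R[i]) = 1.
Proof. exact: ComplexField.Normc.normc1. Qed.

Lemma modulusN (R : realType) (z : R[i]) : modulus (- z) = modulus z.
Proof. exact: normcN. Qed.

Lemma modulusD (R : realType) (x y : R[i]) :
  modulus (x + y) <= modulus x + modulus y.
Proof. exact: le_normcD. Qed.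

Lemma modulusBC (R : realType) (x y : R[i]) : modulus (x - y) = modulus (y - x).
Proof. by rewrite -modulusN opprB. Qed.

Lemma modulusB_ge (R : realType) (x y : R[i]) :
  modulus x - modulus y <= modulus (x - y).
Proof. by rewrite lerBlDr -{1}(subrK y x) modulusD. Qed.

Lemma modulusX (R : realType) (z : R[i]) n : modulus (z ^+ n) = modulus z ^+ n.
Proof.
by elim: n => [|n IH]; rewrite ?expr0 ?modulus1 // !exprS modulusM IH.
Qed.

Lemma modulus_prod (R : realType) (I : Type) (s : seq I) (P : pred I)
    (F : I -> R[i]) :
  modulus (\prod_(i <- s | P i) F i) = \prod_(i <- s | P i) modulus (F i).
Proof. by apply: (big_morph _ (@modulusM R)); apply: modulus1. Qed.

Lemma modulus_sum (R : realType) (I : Type) (s : seq I) (P : pred I)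
    (F : I -> R[i]) :
  modulus (\sum_(i <- s | P i) F i) <= \sum_(i <- s | P i) modulus (F i).
Proof.
elim/big_rec2: _ => [|i x y _ xy]; first by rewrite modulus0.
by apply: le_trans (modulusD _ _) _; rewrite lerD2l.
Qed.

Lemma modulus_realE (R : realType) (x : R) : modulus x%:C = `|x|.
Proof. by rewrite /modulus /= expr0n addr0 sqrtr_sqr. Qed.

Lemma modulus_real (R : realType) (x : R) : 0 <= x -> modulus x%:C = x.
Proof. by move=> x0; rewrite modulus_realE ger0_norm. Qed.

(* Otherwise unification unfolds the modulus down to square roots. *)
#[local] Opaque modulus.

(** * Roots and Mahler measures on circles *)

(** The roots of p, each repeated according to its multiplicity. *)
Definition roots_seq (R : realType) (p : {poly R[i]}) : seq R[i] :=
  sval (closed_field_poly_normal p).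

Lemma roots_seqE (R : realType) (p : {poly R[i]}) :
  p = lead_coef p *: \prod_(z <- roots_seq p) ('X - z%:P).
Proof. exact: svalP (closed_field_poly_normal p). Qed.

Lemma mem_roots_seq (R : realType) (p : {poly R[i]}) z :
  p != 0 -> (z \in roots_seq p) = root p z.
Proof.
move=> p0; rewrite {2}(roots_seqE p) rootZ ?lead_coef_eq0 //.
by rewrite root_prod_XsubC.
Qed.

Lemma size_roots_seq (R : realType) (p : {poly R[i]}) :
  p != 0 -> (size (roots_seq p)).+1 = size p.
Proof.
move=> p0; rewrite {2}(roots_seqE p) size_scale ?lead_coef_eq0 //.
by rewrite size_prod_XsubC.
Qed.

Lemma modulus_horner (R : realType) (p : {poly R[i]}) w :
  modulus p.[w] =
    modulus (lead_coef p) * \prod_(z <- roots_seq p) modulus (w - z).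
Proof.
rewrite {1}(roots_seqE p) hornerZ modulusM horner_prod modulus_prod.
by congr (_ * _); apply: eq_bigr => z _; rewrite !hornerE.
Qed.

(** The Mahler measure of p relative to the circle of radius x: by Jensen's
formula, the exponential of the mean of the logarithm of |p| on it. *)
Definition mahler (R : realType) (p : {poly R[i]}) (x : R) : R :=
  modulus (lead_coef p) * \prod_(z <- roots_seq p) Num.max x (modulus z).

Lemma mahler_gt0 (R : realType) (p : {poly R[i]}) x :
  p != 0 -> 0 < x -> 0 < mahler p x.
Proof.
move=> p0 x0; rewrite mulr_gt0 ?modulus_gt0 ?lead_coef_eq0 //.
by apply: prodr_gt0 => z _; rewrite lt_max x0.
Qed.

(** The points x * w with w ranging over the N-th roots of unity, for N > 0. *)
Definition circle_points (R : realType) (N : nat) (x : R) : seq R[i] :=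
  roots_seq ('X^N - (x%:C ^+ N)%:P).

Lemma circle_pointsE (R : realType) N (x : R) : (0 < N)%N ->
  'X^N - (x%:C ^+ N)%:P = \prod_(w <- circle_points N x) ('X - w%:P).
Proof.
by move=> N0; rewrite {1}(roots_seqE (_ - _)) lead_coefXnsubC // scale1r.
Qed.

Lemma size_circle_points (R : realType) N (x : R) : (0 < N)%N ->
  size (circle_points N x) = N.
Proof.
move=> N0; apply/succn_inj; rewrite -(size_prod_XsubC _ id) -circle_pointsE //.
by rewrite size_XnsubC.
Qed.

Lemma modulus_circle_points (R : realType) N (x : R) w : (0 < N)%N -> 0 <= x ->
  w \in circle_points N x -> modulus w = x.
Proof.
move=> N0 x0; rewrite -root_prod_XsubC -circle_pointsE // /root !hornerE.
rewrite subr_eq0 => /eqP /(congr1 (@modulus R)).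
rewrite !modulusX modulus_real // => /eqP.
by rewrite eqrXn2 ?modulus_ge0 // => /eqP.
Qed.

Lemma prod_circle_points (R : realType) (p : {poly R[i]}) N (x : R) :
  (0 < N)%N ->
  \prod_(w <- circle_points N x) modulus p.[w] =
    modulus (lead_coef p) ^+ N *
      \prod_(z <- roots_seq p) modulus (z ^+ N - x%:C ^+ N).
Proof.
move=> N0; under eq_bigr do rewrite modulus_horner.
rewrite big_split exchange_big big_const_seq iter_mulr_1 count_predT.
rewrite size_circle_points //=; congr (_ * _); apply: eq_bigr => z _.
have := congr1 (horner^~ z) (circle_pointsE x N0).
rewrite !hornerE horner_prod => ->; rewrite modulus_prod.
by apply: eq_bigr => w _; rewrite !hornerE modulusBC.
Qed.

Lemma bernoulli_le (R : realType) (a : R) N :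
  0 <= a -> 1 + a *+ N <= (1 + a) ^+ N.
Proof.
move=> a0; elim: N => [|N IH]; first by rewrite mulr0n addr0 expr0.
rewrite exprS; apply: le_trans (ler_wpM2l _ IH); last by rewrite addr_ge0.
rewrite mulrDr mulr1 mulrDl mul1r mulrS !addrA lerDl.
by rewrite mulr_ge0 // mulrn_wge0.
Qed.

Lemma exprn_dominates (R : realType) (a b B : R) : 0 <= a < b ->
  exists N0, forall N, (N0 <= N)%N -> B * a ^+ N <= b ^+ N.
Proof.
case/andP=> a0 ab; have b0 : 0 < b by apply: le_lt_trans ab.
move: a0; rewrite le_eqVlt => /predU1P[<-|a0].
  exists 1%N => -[//|N] _; rewrite expr0n mulr0; exact/exprn_ge0/ltW.
pose c := b / a - 1.
have c0 : 0 < c by rewrite subr_gt0 ltr_pdivlMr // mul1r.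
exists (Num.Def.archi_bound `|B / c|) => N leN.
rewrite -ler_pdivlMr ?exprn_gt0 // -expr_div_n.
have -> : b / a = 1 + c by rewrite addrC subrK.
apply: le_trans (bernoulli_le _ (ltW c0)).
suff : B <= c *+ N by move=> /le_trans->//; rewrite lerDr.
rewrite -mulr_natl -ler_pdivrMr //.
apply: le_trans (ler_norm _) _; apply: ltW.
apply: lt_le_trans (archi_boundP (normr_ge0 _)) _.
by rewrite ler_nat.
Qed.

Lemma ler_prod_scale (R : realType) (T : eqType) (s : seq T) (B : R)
    (F G : T -> R) :
  (forall z, z \in s -> 0 <= F z <= B * G z) ->
  \prod_(z <- s) F z <= B ^+ size s * \prod_(z <- s) G z.
Proof.
move=> FG.
have -> : B ^+ size s * \prod_(z <- s) G z = \prod_(z <- s) (B * G z).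
  by rewrite big_split big_const_seq iter_mulr_1 count_predT.
by rewrite !big_seq; apply: ler_prod.
Qed.

Lemma prod_circle_points_le (R : realType) (p : {poly R[i]}) N (x : R) :
  (0 < N)%N -> 0 <= x ->
  \prod_(w <- circle_points N x) modulus p.[w] <=
    2 ^+ size (roots_seq p) * mahler p x ^+ N.
Proof.
move=> N0 x0; rewrite prod_circle_points // exprMn mulrCA -prodrXl.
apply: ler_wpM2l; first by rewrite exprn_ge0 ?modulus_ge0.
apply: ler_prod_scale => z _; rewrite modulus_ge0 /=.
apply: le_trans (modulusD _ _) _; rewrite modulusN !modulusX modulus_real //.
rewrite mulr_natl mulr2n; apply: lerD; rewrite lerXn2r ?nnegrE ?modulus_ge0 //.
all: by rewrite ?le_max ?lexx ?x0 ?orbT.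
Qed.

Lemma prod_circle_points_ge (R : realType) (p : {poly R[i]}) (x : R) :
  0 < x -> (forall z, z \in roots_seq p -> modulus z != x) ->
  exists N0, forall N, (N0 <= N)%N ->
    mahler p x ^+ N <=
      2 ^+ size (roots_seq p) * \prod_(w <- circle_points N x) modulus p.[w].
Proof.
move=> x0 nroot.
(* For |z| <> x, the larger of |z|^N and x^N eventually is at least twice the
   smaller one. *)
suff [N0 leN0] : exists N0, forall N, (N0 <= N)%N ->
    forall z, z \in roots_seq p ->
    Num.max x (modulus z) ^+ N <= 2 * modulus (z ^+ N - x%:C ^+ N).
  exists N0.+1 => N leN; rewrite prod_circle_points ?(leq_trans _ leN) //.
  rewrite exprMn mulrCA -prodrXl.
  apply: ler_wpM2l; first by rewrite exprn_ge0 ?modulus_ge0.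
  apply: ler_prod_scale => z zp; rewrite leN0 ?(ltnW leN) // andbT.
  by rewrite exprn_ge0 // le_max (ltW x0).
elim: (roots_seq p) nroot => [|z s IH] nroot; first by exists 0%N.
have [|N1 leN1] := IH; first by move=> y ys; apply: nroot; rewrite inE ys orbT.
have [N2 leN2] : exists N0, forall N, (N0 <= N)%N ->
    Num.max x (modulus z) ^+ N <= 2 * modulus (z ^+ N - x%:C ^+ N).
  have := nroot z (mem_head _ _); rewrite neq_lt => /orP[] zx.
    have [|N2 leN2] := @exprn_dominates R (modulus z) x 2.
      by rewrite modulus_ge0.
    exists N2 => N /leN2; rewrite modulusBC.
    have := modulusB_ge (x%:C ^+ N) (z ^+ N).
    rewrite !modulusX modulus_real ?(ltW x0) // max_l ?(ltW zx) //; lra.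
  have [|N2 leN2] := @exprn_dominates R x (modulus z) 2.
    by rewrite (ltW x0).
  exists N2 => N /leN2.
  have := modulusB_ge (z ^+ N) (x%:C ^+ N).
  rewrite !modulusX modulus_real ?(ltW x0) // max_r ?(ltW zx) //; lra.
exists (maxn N1 N2) => N; rewrite geq_max => /andP[le1 le2] y.
by rewrite inE => /predU1P[->|]; [apply: leN2|apply: leN1].
Qed.

(** Comparing |p| and |q| at N equidistributed points of the circle and letting
N tend to infinity compares the Mahler measures. *)
Lemma mahler_le (R : realType) (p q : {poly R[i]}) (x B : R) :
  0 < x -> 0 < B -> q != 0 ->
  (forall z, z \in roots_seq p -> modulus z != x) ->
  (forall w, modulus w = x -> modulus p.[w] <= B * modulus q.[w]) ->
  mahler p x <= B * mahler q x.
Proof.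
move=> x0 B0 q0 nroot pq; rewrite leNgt; apply/negP => gt.
have BMq0 : 0 < B * mahler q x by rewrite mulr_gt0 ?mahler_gt0.
(* If M(p) > B M(q), then M(p)^N outgrows K (B M(q))^N, but the products over
   the circle bound the former by the latter. *)
pose K : R := 2 ^+ size (roots_seq p) * 2 ^+ size (roots_seq q).
have K0 : 0 < K by rewrite mulr_gt0 ?exprn_gt0.
have [|N1 leN1] := @exprn_dominates R (B * mahler q x) (mahler p x) (K + 1).
  by rewrite ltW.
have [N2 leN2] := prod_circle_points_ge x0 nroot.
have [N [N_gt0 /leN1 h1 /leN2 h2]] : exists N, [/\ 0 < N, N1 <= N & N2 <= N]%N.
  exists (maxn N1 N2).+1.
  by split=> //; rewrite ltnW // ltnS ?leq_maxl ?leq_maxr.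
have := le_trans h1 h2; apply/negP; rewrite -ltNge.
suff : \prod_(w <- circle_points N x) modulus p.[w] <=
    B ^+ N * (2 ^+ size (roots_seq q) * mahler q x ^+ N).
  move=> h3; apply: le_lt_trans (ler_wpM2l _ h3) _; first by rewrite exprn_ge0.
  rewrite [ltLHS](_ : _ = K * (B * mahler q x) ^+ N).
    by rewrite mulrDl mul1r ltrDl exprn_gt0.
  by rewrite (exprMn _ B (mahler q x)) /K -mulrA; congr (_ * _); rewrite mulrCA.
have := prod_circle_points_le q N_gt0 (ltW x0).
rewrite -(ler_pM2l (exprn_gt0 N B0)) => /(le_trans _); apply.
rewrite -{2}(size_circle_points x N_gt0).
apply: ler_prod_scale => w wx; rewrite modulus_ge0 /= pq //.
exact: modulus_circle_points N_gt0 (ltW x0) wx.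
Qed.

(** The numbers of roots of p, counted with multiplicity, in the open and in
the closed disc of radius r. *)
Definition nroots_lt (R : realType) (p : {poly R[i]}) (r : R) : nat :=
  count (fun z => modulus z < r) (roots_seq p).

Definition nroots_le (R : realType) (p : {poly R[i]}) (r : R) : nat :=
  count (fun z => modulus z <= r) (roots_seq p).

(** Between x and y, a factor max(x, |z|) of the Mahler measure grows at most by
y / x if |z| < y, and not at all otherwise. *)
Lemma mahler_growth_le (R : realType) (p : {poly R[i]}) (x y : R) :
  0 < x <= y ->
  mahler p y * x ^+ nroots_lt p y <= mahler p x * y ^+ nroots_lt p y.
Proof.
case/andP=> x0 xy; have y0 := lt_le_trans x0 xy.
rewrite /mahler /nroots_lt /nroots_le -!mulrA ler_wpM2l ?modulus_ge0 //.
elim: (roots_seq p) => [|z s IH]; first by rewrite !big_nil !expr0.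
rewrite !big_cons /= !exprD mulrACA [leRHS]mulrACA.
apply: ler_pM => //.
- by rewrite mulr_ge0 // ?le_max ?(ltW y0) ?exprn_ge0 ?(ltW x0).
- apply: mulr_ge0; last by rewrite exprn_ge0 ?(ltW x0).
  by apply: prodr_ge0 => u _; rewrite le_max (ltW y0).
case: (boolP (modulus z < y)) => [yz|]; last first.
  rewrite -leNgt => yz; rewrite !expr0 !mulr1 max_r //.
  by rewrite le_max lexx orbT.
rewrite !expr1 max_l ?(ltW yz) // mulrC ler_wpM2r ?(ltW y0) //.
by rewrite le_max lexx.
Qed.

(** Between x and y, a factor max(x, |z|) of the Mahler measure grows exactly by
y / x if |z| <= x, and does not decrease otherwise. *)
Lemma mahler_growth_ge (R : realType) (p : {poly R[i]}) (x y : R) :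
  0 < x <= y ->
  mahler p x * y ^+ nroots_le p x <= mahler p y * x ^+ nroots_le p x.
Proof.
case/andP=> x0 xy; have y0 := lt_le_trans x0 xy.
rewrite /mahler /nroots_lt /nroots_le -!mulrA ler_wpM2l ?modulus_ge0 //.
elim: (roots_seq p) => [|z s IH]; first by rewrite !big_nil !expr0.
rewrite !big_cons /= !exprD mulrACA [leRHS]mulrACA.
apply: ler_pM => //.
- by rewrite mulr_ge0 // ?le_max ?(ltW x0) ?exprn_ge0 ?(ltW y0).
- apply: mulr_ge0; last by rewrite exprn_ge0 ?(ltW y0).
  by apply: prodr_ge0 => u _; rewrite le_max (ltW x0).
case: (boolP (modulus z <= x)) => [xz|_].
  by rewrite !expr1 !max_l ?(le_trans xz xy) // mulrC.
by rewrite !expr0 !mulr1 ge_max !le_max xy lexx orbT.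
Qed.

(** * Stability of the number of roots *)

Lemma horner_modulus_gt0 (R : realType) (p : {poly R[i]}) (x : R) :
  p != 0 -> (forall z, z \in roots_seq p -> modulus z != x) ->
  exists2 c : R, 0 < c & forall w, modulus w = x -> c <= modulus p.[w].
Proof.
move=> p0 nroot.
exists (modulus (lead_coef p) * \prod_(z <- roots_seq p) `|x - modulus z|).
  rewrite mulr_gt0 ?modulus_gt0 ?lead_coef_eq0 // big_seq.
  by apply: prodr_gt0 => z zp; rewrite normr_gt0 subr_eq0 eq_sym nroot.
move=> w wx; rewrite modulus_horner ler_wpM2l ?modulus_ge0 //.
apply: ler_prod => z _; rewrite normr_ge0 /= -wx ler_norml modulusB_ge andbT.
by rewrite lerNl opprB modulusBC modulusB_ge.
Qed.

Lemma expr_cross_leq (R : realType) (x y B : R) (a b : nat) :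
  0 < x < y -> 0 <= B -> B * x < y ->
  y ^+ a * x ^+ b <= B * (y ^+ b * x ^+ a) ->
  (a <= b)%N.
Proof.
case/andP=> x0 xy B0 Bxy le_ab; rewrite leqNgt; apply/negP => /subnKC.
set k := (a - b.+1)%N => ka.
move: le_ab; rewrite -ka; apply/negP; rewrite -ltNge.
have y0 := lt_trans x0 xy.
rewrite addSn -addnS !exprD [ltRHS]mulrAC [y ^+ b * (_ * _)]mulrA mulrCA.
rewrite ltr_pM2l ?mulr_gt0 ?exprn_gt0 // !exprS mulrA.
apply: lt_le_trans (_ : y * x ^+ k <= _); first by rewrite ltr_pM2r ?exprn_gt0.
by rewrite ler_pM2l // lerXn2r ?nnegrE ?(ltW x0) ?(ltW y0) ?(ltW xy).
Qed.

(** If p and q are close on two circles of radii x < y, relative to their size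
there and to y / x, the growth of the Mahler measure of q between the two
circles bounds that of p, and hence the root counts compare. *)
Lemma count_roots_le (R : realType) (p q : {poly R[i]}) (x y c d : R) :
  0 < x < y -> 0 < c -> 0 <= d -> (1 + d / c) ^+ 2 * x < y ->
  (forall w, modulus w = x \/ modulus w = y ->
    [/\ c <= modulus p.[w], c <= modulus q.[w]
      & modulus (p.[w] - q.[w]) <= d]) ->
  (nroots_le p x <= nroots_lt q y)%N.
Proof.
move=> /andP[x0 xy] c0 d0 Bxy close; set B := 1 + d / c in Bxy.
have y0 := lt_trans x0 xy.
have dc0 : 0 <= d / c by rewrite divr_ge0 // ltW.
have B0 : 0 < B by rewrite ltr_pwDl.
have le_B (u v : R[i]) : c <= modulus v -> modulus (u - v) <= d ->
    modulus u <= B * modulus v.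
  move=> cv uv; rewrite mulrDl mul1r -lerBlDl.
  apply: le_trans (modulusB_ge _ _) (le_trans uv _).
  by rewrite -{1}(divfK (lt0r_neq0 c0) d) ler_wpM2l.
have nz (u : {poly R[i]}) (w : R[i]) : c <= modulus u.[w] -> u != 0.
  move=> cu; apply: contraTneq cu => ->.
  by rewrite horner0 modulus0 -ltNge.
have wx : modulus x%:C = x by rewrite modulus_real // ltW.
have [/nz p0 /nz q0 _] := close x%:C (or_introl wx).
have nroot (u : {poly R[i]}) (t : R) : u != 0 ->
    (forall w, modulus w = t -> c <= modulus u.[w]) ->
    forall z, z \in roots_seq u -> modulus z != t.
  move=> u0 cu z; rewrite mem_roots_seq // => /rootP uz; apply: contraTneq c0.
  by move=> /cu; rewrite uz modulus0 -leNgt.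
have Mpq : mahler p y <= B * mahler q y.
  apply: mahler_le => // [|w wy].
    by apply: nroot => // w wy; have [] := close w (or_intror wy).
  by have [] := close w (or_intror wy) => _; apply: le_B.
have Mqp : mahler q x <= B * mahler p x.
  apply: mahler_le => // [|w wy].
    by apply: nroot => // w wy; have [] := close w (or_introl wy).
  have [cp _ pq] := close w (or_introl wy); apply: le_B => //.
  by rewrite modulusBC.
set a := nroots_le p x; set b := nroots_lt q y.
have x0y : 0 < x <= y by rewrite x0 ltW.
have := mahler_growth_ge p x0y; have := mahler_growth_le q x0y.
rewrite -/a -/b; move: (mahler_gt0 p0 x0) Mpq Mqp.
move: (mahler p x) (mahler p y) (mahler q x) (mahler q y).
move: a b => a b Px Py Qx Qy Px0 Mpq Mqp gq gp.
apply: (@expr_cross_leq _ x y (B ^+ 2)); rewrite ?x0 ?exprn_ge0 ?(ltW B0) //.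
rewrite -(ler_pM2l Px0) [leLHS]mulrA.
have xa0 : 0 <= x ^+ a by rewrite exprn_ge0 // ltW.
have xb0 : 0 <= x ^+ b by rewrite exprn_ge0 // ltW.
have yb0 : 0 <= y ^+ b by rewrite exprn_ge0 // ltW.
apply: le_trans (ler_wpM2r xb0 gp) _.
apply: le_trans (ler_wpM2r xb0 (ler_wpM2r xa0 Mpq)) _.
rewrite -!mulrA [x ^+ a * _]mulrC [Qy * _]mulrA.
apply: le_trans (ler_wpM2l (ltW B0) (ler_wpM2r xa0 gq)) _.
apply: le_trans (ler_wpM2l (ltW B0) (ler_wpM2r xa0 (ler_wpM2r yb0 Mqp))) _.
by rewrite le_eqVlt; apply/orP; left; apply/eqP; ring.
Qed.

Lemma count_roots_stable (R : realType) (p : {poly R[i]}) (x y : R) :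
  p != 0 -> 0 < x < y ->
  (forall z, z \in roots_seq p -> modulus z != x /\ modulus z != y) ->
  exists2 d : R, 0 < d & forall q : {poly R[i]},
    (forall w, modulus w = x \/ modulus w = y ->
       modulus (p.[w] - q.[w]) <= d) ->
    (nroots_le p x <= nroots_lt q y)%N /\
    (nroots_le q x <= nroots_lt p y)%N.
Proof.
move=> p0 xy nroot; have /andP[x0 lt_xy] := xy.
have [|c1 c1_gt0 le_c1] := @horner_modulus_gt0 _ p x p0.
  by move=> z /nroot[].
have [|c2 c2_gt0 le_c2] := @horner_modulus_gt0 _ p y p0.
  by move=> z /nroot[].
pose c := Num.min c1 c2 / 2.
have c0 : 0 < c by rewrite divr_gt0 // lt_min c1_gt0.
(* For 0 < u <= 1, (1 + u)^2 <= 1 + 3 u < y / x. *)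
pose u := Num.min 1 ((y / x - 1) / 4).
have yx1 : 1 < y / x by rewrite ltr_pdivlMr // mul1r.
have u0 : 0 < u by rewrite lt_min ltr01 /= divr_gt0 // subr_gt0.
have u1 : u <= 1 by rewrite ge_min lexx.
have uyx : u <= (y / x - 1) / 4 by rewrite ge_min lexx orbT.
have d0 : 0 < c * u by rewrite mulr_gt0.
have Bxy : (1 + c * u / c) ^+ 2 * x < y.
  have -> : c * u / c = u by rewrite mulrAC divff ?mul1r ?lt0r_neq0.
  rewrite -ltr_pdivlMr //; nra.
exists (c * u) => // q pq.
have cp w : modulus w = x \/ modulus w = y -> 2 * c <= modulus p.[w].
  rewrite mulrC divfK ?pnatr_eq0 // => -[/le_c1|/le_c2]; apply: le_trans.
    by rewrite ge_min lexx.
  by rewrite ge_min lexx orbT.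
have cq w : modulus w = x \/ modulus w = y -> c <= modulus q.[w].
  move=> wxy; have := cp w wxy; have := pq w wxy.
  have := modulusB_ge p.[w] q.[w].
  have : c * u <= c by rewrite ger_pMr.
  lra.
have cp' w : modulus w = x \/ modulus w = y -> c <= modulus p.[w].
  by move=> /cp; apply: le_trans; lra.
split; apply: (count_roots_le xy c0 (ltW d0) Bxy) => w wxy.
  by split; [apply: cp'|apply: cq|apply: pq].
by split; [apply: cq|apply: cp'|rewrite modulusBC; apply: pq].
Qed.

Lemma gap_below (R : realType) (s : seq R) (r : R) : 0 < r ->
  exists2 x, 0 < x < r & forall a, a \in s -> a < r -> a < x.
Proof.
move=> r0; elim: s => [|a s [x /andP[x0 xr] IH]].
  by exists (r / 2) => //; apply/andP; split; lra.
have [ar|ra] := ltP a r; last first.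
  exists x; first by rewrite x0.
  by move=> b; rewrite inE => /predU1P[->|/IH//]; rewrite ltNge ra.
exists (Num.max x ((a + r) / 2)).
  by rewrite lt_max x0 gt_max xr /=; lra.
move=> b; rewrite inE => /predU1P[-> _|/IH/[apply]]; rewrite lt_max.
  by apply/orP; right; lra.
by move=> ->.
Qed.

Lemma gap_above (R : realType) (s : seq R) (r : R) :
  exists2 x, r < x < r + 1 & forall a, a \in s -> r < a -> x < a.
Proof.
elim: s => [|a s [x /andP[x0 xr] IH]].
  by exists (r + 1 / 2) => //; apply/andP; split; lra.
have [ar|ra] := ltP r a; last first.
  exists x; first by rewrite x0.
  by move=> b; rewrite inE => /predU1P[->|/IH//]; rewrite ltNge ra.
exists (Num.min x ((a + r) / 2)).
  by rewrite gt_min xr lt_min x0 /=; lra.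
move=> b; rewrite inE => /predU1P[-> _|/IH/[apply]]; rewrite gt_min.
  by apply/orP; right; lra.
by move=> ->.
Qed.

Lemma leq_in_count (T : eqType) (a b : pred T) (s : seq T) :
  {in s, forall z, a z -> b z} -> (count a s <= count b s)%N.
Proof.
move=> ab; rewrite -!size_filter -(@eq_in_filter _ (predI b a)).
  by rewrite filter_predI !size_filter leq_count_subseq ?filter_subseq.
by move=> z zs /=; apply/andP/idP => [[]|az] //; split=> //; apply: ab.
Qed.

(** Hurwitz' theorem in semicontinuity form: a small perturbation of p loses no
root of the open disc and gains no root in the closed disc. *)
Lemma hurwitz (R : realType) (p : {poly R[i]}) (r : R) : p != 0 -> 0 < r ->
  exists2 d : R, 0 < d & forall q : {poly R[i]},
    (forall w, modulus w <= r + 1 -> modulus (p.[w] - q.[w]) <= d) ->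
    (nroots_lt p r <= nroots_lt q r)%N /\
    (nroots_le q r <= nroots_le p r)%N.
Proof.
move=> p0 r0; pose s := map (@modulus R) (roots_seq p).
have [x1 /andP[x1_gt0 x1r] gap1] := gap_below s r0.
have [y2 /andP[ry2 y2r] gap2] := gap_above s r.
(* The circles x1 < y1 < r and r < x2 < y2 are such that no root has a modulus
   in [x1, r[ or in ]r, y2]. *)
pose y1 := (x1 + r) / 2; pose x2 := (r + y2) / 2.
have x1y1 : x1 < y1 by rewrite /y1; lra.
have y1r : y1 < r by rewrite /y1; lra.
have rx2 : r < x2 by rewrite /x2; lra.
have x2y2 : x2 < y2 by rewrite /x2; lra.
have ms z : z \in roots_seq p -> modulus z \in s by apply: map_f.
have [||d1 d1_gt0 st1] := @count_roots_stable _ p x1 y1 p0.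
- by rewrite x1_gt0.
- move=> z /ms /gap1 zx; split; apply/eqP => zE; move: zx; rewrite zE.
    by move=> /(_ x1r); rewrite ltxx.
  by move=> /(_ y1r) /(lt_trans x1y1); rewrite ltxx.
have [||d2 d2_gt0 st2] := @count_roots_stable _ p x2 y2 p0.
- by rewrite x2y2 (lt_trans r0).
- move=> z /ms /gap2 zx; split; apply/eqP => zE; move: zx; rewrite zE.
    by move=> /(_ rx2) /(lt_trans x2y2); rewrite ltxx.
  by move=> /(_ ry2); rewrite ltxx.
exists (Num.min d1 d2) => [|q pq]; first by rewrite lt_min d1_gt0.
have [|le1 _] := st1 q.
  move=> w wxy; apply: le_trans (pq w _) _; last by rewrite ge_min lexx.
  by case: wxy => ->; lra.
have [|_ le2] := st2 q.
  move=> w wxy; apply: le_trans (pq w _) _; last by rewrite ge_min lexx orbT.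
  by case: wxy => ->; lra.
split.
  apply: leq_trans (leq_trans le1 _).
    by apply: leq_in_count => z /ms /gap1 zx /zx; apply: ltW.
  by apply: sub_count => z zy1; apply: lt_trans y1r.
apply: leq_trans (leq_trans le2 _).
  by apply: sub_count => z /= zr; apply: ltW; apply: le_lt_trans rx2.
apply: leq_in_count => z /ms /gap2 zx /= zy2; rewrite leNgt.
by apply/negP => /zx; apply/negP; rewrite -leNgt ltW.
Qed.

(** * Invariance of the number of roots along a homotopy *)

Lemma horner_bounded (R : realType) (p : {poly R[i]}) (r : R) : 0 <= r ->
  exists2 K : R, 0 < K & forall w, modulus w <= r -> modulus p.[w] <= K.
Proof.
move=> r0; elim/poly_ind: p => [|p c [K K0 leK]].
  by exists 1 => // w _; rewrite horner0 modulus0.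
exists (K * r + modulus c + 1) => [|w wr].
  by rewrite ltr_wpDl // addr_ge0 ?modulus_ge0 // mulr_ge0 // ltW.
rewrite !hornerE; apply: le_trans (modulusD _ _) _; rewrite modulusM.
have : modulus p.[w] * modulus w <= K * r.
  by apply: ler_pM; rewrite ?modulus_ge0 ?leK.
lra.
Qed.

(** A polynomial D in an indeterminate over {poly R[i]} is regarded as a family
of polynomials: its member at parameter t is D.[t%:C%:P]. *)
Lemma family_lipschitz (R : realType) (D : {poly {poly R[i]}}) (r : R) :
  0 <= r ->
  exists2 K : R, 0 < K & forall (s t : R) w, 0 <= s <= 1 -> 0 <= t <= 1 ->
    modulus w <= r ->
    modulus (D.[s%:C%:P].[w] - D.[t%:C%:P].[w]) <= K * `|s - t|.
Proof.
move=> r0.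
suff [K K0 leK] : exists2 K : R, 0 < K & forall (s t : R) w, 0 <= s <= 1 ->
    0 <= t <= 1 -> modulus w <= r -> modulus D.[s%:C%:P].[w] <= K /\
    modulus (D.[s%:C%:P].[w] - D.[t%:C%:P].[w]) <= K * `|s - t|.
  by exists K => // s t w hs ht wr; have [] := leK s t w hs ht wr.
elim/poly_ind: D => [|D c [K K0 leK]].
  exists 1 => // s t w _ _ _; rewrite !horner0 subrr modulus0 mul1r normr_ge0.
  by split.
have [L L0 leL] := horner_bounded c r0.
exists (2 * K + L) => [|s t w hs ht wr]; first lra.
have [hDs hDst] := leK s t w hs ht wr; have [hDt _] := leK t s w ht hs wr.
have /andP[s0 s1] := hs; have /andP[t0 t1] := ht.
have := leL w wr; rewrite !hornerE => hc; split.
  apply: le_trans (modulusD _ _) _; rewrite modulusM modulus_real //.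
  have : modulus D.[s%:C%:P].[w] * s <= K * 1.
    by apply: ler_pM; rewrite ?modulus_ge0.
  lra.
have -> : D.[s%:C%:P].[w] * s%:C + c.[w] - (D.[t%:C%:P].[w] * t%:C + c.[w]) =
    (D.[s%:C%:P].[w] - D.[t%:C%:P].[w]) * s%:C + D.[t%:C%:P].[w] * (s - t)%:C.
  by rewrite rmorphB; ring.
apply: le_trans (modulusD _ _) _.
rewrite !modulusM (modulus_real s0) modulus_realE.
have h1 : modulus (D.[s%:C%:P].[w] - D.[t%:C%:P].[w]) * s <= K * `|s - t| * 1.
  by apply: ler_pM; rewrite ?modulus_ge0.
have h2 : modulus D.[t%:C%:P].[w] * `|s - t| <= K * `|s - t|.
  by apply: ler_wpM2r.
have h3 : 0 <= L * `|s - t| by rewrite mulr_ge0 // ltW.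
lra.
Qed.

Lemma family_semicontinuous (R : realType) (D : {poly {poly R[i]}}) (r t : R) :
  0 < r -> 0 <= t <= 1 -> D.[t%:C%:P] != 0 ->
  exists2 e : R, 0 < e & forall s, 0 <= s <= 1 -> `|s - t| < e ->
    (nroots_lt D.[t%:C%:P] r <= nroots_lt D.[s%:C%:P] r)%N /\
    (nroots_le D.[s%:C%:P] r <= nroots_le D.[t%:C%:P] r)%N.
Proof.
move=> r0 ht Dt0; have [d d0 hurw] := hurwitz Dt0 r0.
have [|K K0 lip] := @family_lipschitz _ D (r + 1); first lra.
exists (d / K) => [|s hs st]; first by rewrite divr_gt0.
apply: hurw => w wr; apply: le_trans (lip _ _ _ ht hs wr) _.
by rewrite mulrC -ler_pdivlMr // distrC ltW.
Qed.

Lemma nroots_le_lt (R : realType) (p : {poly R[i]}) (r : R) : p != 0 ->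
  (forall w, modulus w = r -> ~~ root p w) -> nroots_le p r = nroots_lt p r.
Proof.
move=> p0 nroot; apply: eq_in_count => z; rewrite mem_roots_seq // => pz.
rewrite le_eqVlt; case: eqP => //= zr.
by have := nroot z zr; rewrite pz.
Qed.

(** A connectedness argument: where they coincide on [0, 1[, a lower
semicontinuous f and an upper semicontinuous g with natural values are locally
constant there, hence constant, and 1 is reached in the limit. *)
Lemma semicontinuous_nat_bounds (R : realType) (f g : R -> nat) :
  (forall t, 0 <= t < 1 -> g t = f t) ->
  (forall t, 0 <= t <= 1 -> exists2 e : R, 0 < e &
     forall s, 0 <= s <= 1 -> `|s - t| < e ->
     (f t <= f s)%N /\ (g s <= g t)%N) ->
  (f 1%R <= f 0%R <= g 1%R)%N.
Proof.
move=> feq semi.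
pose S : set R :=
  [set t | 0 <= t < 1 /\ forall s, 0 <= s <= t -> f s = f 0]%classic.
have S0 : S 0.
  by split; rewrite ?lexx ?ltr01 // => s; rewrite -eq_le => /eqP <-.
have supS : has_sup S.
  by split; [exists 0|exists 1 => t [/andP[_ /ltW]]].
have s0 : 0 <= sup S by apply: (ub_le_sup supS.2).
have s1 : sup S <= 1 by apply: ge_sup; [exists 0|move=> t [/andP[_ /ltW]]].
have [|e e0 he] := semi (sup S); first by rewrite s0.
have [t [/andP[t0 t1] St] st] := sup_adherent e0 supS.
have ts : t <= sup S.
  by apply: (ub_le_sup supS.2); split => //; apply/andP.
have ft : f t = f 0 by apply: St; rewrite t0 lexx.
have ht : 0 <= t < 1 by rewrite t0.
have [] := he t; first by rewrite t0 ltW.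
  by rewrite ler0_norm ?subr_le0 //; lra.
rewrite (feq t) // ft => le1 le2.
move: s1; rewrite le_eqVlt => /predU1P[s1|s1]; first by rewrite -s1 le1.
(* Otherwise the constancy of f extends beyond the supremum of S. *)
suff : sup S < sup S by rewrite ltxx.
pose u := Num.min (sup S + e / 2) ((sup S + 1) / 2).
have su : sup S < u by rewrite lt_min; apply/andP; split; lra.
apply: (lt_le_trans su); apply: (ub_le_sup supS.2).
have u1 : u < 1 by rewrite gt_min; apply/orP; right; lra.
have ue : u <= sup S + e / 2 by rewrite ge_min lexx.
split; first by rewrite u1 andbT (le_trans s0) // ltW.
move=> v /andP[v0 vu]; have [vt|tv] := leP v t; first by apply: St; rewrite v0.
have hv : 0 <= v < 1 by rewrite v0 (le_lt_trans vu).
have hs : 0 <= sup S < 1 by rewrite s0.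
have [] := he v; first by rewrite v0 ltW // (le_lt_trans vu).
  by rewrite ltr_norml; apply/andP; split; lra.
rewrite (feq _ hv) (feq _ hs) in le2 * => le3 le4.
apply/eqP; rewrite eqn_leq.
by rewrite (leq_trans le4 le1) (leq_trans le2 le3).
Qed.

Lemma family_nroots (R : realType) (D : {poly {poly R[i]}}) (r : R) : 0 < r ->
  D.[1] != 0 ->
  (forall (t : R) w, 0 <= t < 1 -> modulus w = r -> ~~ root D.[t%:C%:P] w) ->
  (nroots_lt D.[1] r <= nroots_lt D.[0] r <= nroots_le D.[1] r)%N.
Proof.
move=> r0 D1 nroot.
have D1E : D.[1] = D.[(1 : R)%:C%:P] by rewrite !rmorph1.
have Dn0 (t : R) : 0 <= t <= 1 -> D.[t%:C%:P] != 0.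
  case/andP=> t0; rewrite le_eqVlt => /predU1P[->|t1]; first by rewrite -D1E.
  have wr : modulus r%:C = r := modulus_real (ltW r0).
  apply: contraNneq (nroot t r%:C (introT andP (conj t0 t1)) wr) => ->.
  exact: root0.
have D0E : D.[0] = D.[(0 : R)%:C%:P] by rewrite !rmorph0.
rewrite D1E D0E.
apply: (@semicontinuous_nat_bounds _ (fun t => nroots_lt D.[t%:C%:P] r)
  (fun t => nroots_le D.[t%:C%:P] r)) => t ht; last first.
  exact: family_semicontinuous r0 ht (Dn0 _ ht).
apply: nroots_le_lt => [|w]; last exact: nroot.
by case/andP: ht => t0 t1; apply: Dn0; rewrite t0 (ltW t1).
Qed.

(** * The spectral norm *)

Lemma trmxC_mul (R : realType) m n p (M : 'M[R[i]]_(m, n))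
    (N : 'M[R[i]]_(n, p)) :
  (M *m N) ^t* = N ^t* *m M ^t*.
Proof. by rewrite trmx_mul map_mxM. Qed.

(** The Hermitian norm of a column vector. *)
Definition vnorm (R : realType) (m : nat) (v : 'cV[R[i]]_m) : R :=
  Num.sqrt (\sum_i modulus (v i 0) ^+ 2).

Lemma vnorm_ge0 (R : realType) m (v : 'cV[R[i]]_m) : 0 <= vnorm v.
Proof. exact: sqrtr_ge0. Qed.

Lemma vnorm_sqr_sum (R : realType) m (v : 'cV[R[i]]_m) :
  vnorm v ^+ 2 = \sum_i modulus (v i 0) ^+ 2.
Proof. by rewrite sqr_sqrtr // sumr_ge0 // => i _; apply: sqr_ge0. Qed.

#[local] Opaque vnorm.

Lemma vnorm_sqr (R : realType) m (v : 'cV[R[i]]_m) :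
  (vnorm v ^+ 2)%:C = (v ^t* *m v) 0 0.
Proof.
rewrite vnorm_sqr_sum mxE rmorph_sum /=; apply: eq_bigr => i _.
by rewrite !mxE mulrC -normCK modulus_normE rmorphXn.
Qed.

Lemma vnorm_sqrtC (R : realType) m (v : 'cV[R[i]]_m) :
  (vnorm v)%:C = sqrtC (dotmx (v ^t*) (v ^t*)).
Proof.
have v0 : 0 <= (vnorm v)%:C by rewrite lecR vnorm_ge0.
by rewrite dotmxE trmxCK -vnorm_sqr rmorphXn /= sqrCK.
Qed.

Lemma vnorm_gt0 (R : realType) m (v : 'cV[R[i]]_m) : v != 0 -> 0 < vnorm v.
Proof.
move=> v0; rewrite -ltcR vnorm_sqrtC sqrt_dnorm_gt0.
by apply: contra_neq v0 => v0; rewrite -[v]trmxCK v0 trmx0 map_mx0.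
Qed.

Lemma vnormZ (R : realType) m a (v : 'cV[R[i]]_m) :
  vnorm (a *: v) = modulus a * vnorm v.
Proof.
apply/eqP; rewrite -(@eqrXn2 _ 2) ?mulr_ge0 ?modulus_ge0 ?vnorm_ge0 //.
rewrite exprMn !vnorm_sqr_sum mulr_sumr; apply/eqP/eq_bigr => i _.
by rewrite mxE modulusM exprMn.
Qed.

Lemma vnormD (R : realType) m (u v : 'cV[R[i]]_m) :
  vnorm (u + v) <= vnorm u + vnorm v.
Proof.
rewrite -lecR rmorphD /= !vnorm_sqrtC linearD /= map_mxD.
exact: (triangle_lerif (@dotmx _ m)).
Qed.

Lemma vnorm0 (R : realType) m : vnorm (0 : 'cV[R[i]]_m) = 0.
Proof. by rewrite -[0](scale0r 0) vnormZ modulus0 mul0r. Qed.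

Lemma vnorm_sum (R : realType) m (I : Type) (s : seq I) (P : pred I)
    (F : I -> 'cV[R[i]]_m) :
  vnorm (\sum_(i <- s | P i) F i) <= \sum_(i <- s | P i) vnorm (F i).
Proof.
elim/big_rec2: _ => [|i x y _ xy]; first by rewrite vnorm0.
by apply: le_trans (vnormD _ _) _; rewrite lerD2l.
Qed.

Lemma eigenvalue_le_spectral_radius (R : realType) m (M : 'M[R[i]]_m) l :
  eigenvalue M l -> modulus l <= spectral_radius M.
Proof.
move=> Ml; apply: ub_le_sup; last by exists l.
exists (\sum_(z <- roots_seq (char_poly M)) modulus z) => _ [z /= Mz <-].
have : z \in roots_seq (char_poly M).
  rewrite mem_roots_seq -?eigenvalue_root_char //.
  by rewrite monic_neq0 ?char_poly_monic.
move=> /(perm_to_rem)/(perm_big _) ->; rewrite big_cons lerDl.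
by apply: sumr_ge0 => u _; apply: modulus_ge0.
Qed.

Lemma spectral_radius_ge0 (R : realType) m (M : 'M[R[i]]_m) :
  0 <= spectral_radius M.
Proof.
case: m M => [|m] M.
  rewrite /spectral_radius.
  suff -> : [set modulus l | l in [set l | eigenvalue M l]]%classic = set0.
    by rewrite sup0.
  rewrite -subset0 => x [z /= /eigenvalueP[u _]].
  by rewrite [u]thinmx0 eqxx.
have [l Ml] := eigenvalue_closed M (ltn0Sn m).
exact: le_trans (modulus_ge0 _) (eigenvalue_le_spectral_radius Ml).
Qed.

Lemma spectral_diag_eigenvalue (R : realType) m (M : 'M[R[i]]_m) i :
  M \is normalmx -> eigenvalue M (spectral_diag M 0 i).
Proof.
move=> /orthomx_spectralP Mdiag; set P := spectralmx M in Mdiag.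
have Pu : P \in unitmx := spectral_unit M.
apply/eigenvalueP; exists (row i P).
  rewrite {1}Mdiag -row_mul -mulmxA (mulKVmx Pu) row_mul row_diag_mx -scalemxAl.
  by rewrite -rowE.
apply/eqP => /(congr1 (fun N => N *m invmx P)); rewrite rowE mulmxK // mul0mx.
by move=> /matrixP /(_ 0 i) /eqP; rewrite !mxE !eqxx oner_eq0.
Qed.

(** In an orthonormal basis of eigenvectors of the normal matrix M^* M, the
squared norm v^* M^* M v is a sum of |y_i|^2 weighted by eigenvalues. *)
Lemma vnorm_mulmx (R : realType) m (M : 'M[R[i]]_m) (v : 'cV[R[i]]_m) :
  vnorm (M *m v) <= spectral_norm M * vnorm v.
Proof.
set H := M ^t* *m M.
have Hn : H \is normalmx.
  by apply/normalmxP; rewrite /H trmxC_mul trmxCK.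
rewrite -(@ler_pXn2r _ 2) ?nnegrE ?mulr_ge0 ?vnorm_ge0 ?sqrtr_ge0 //.
rewrite exprMn [spectral_norm M ^+ 2]sqr_sqrtr ?spectral_radius_ge0 // -/H.
have le_rho i : modulus (spectral_diag H 0 i) <= spectral_radius H.
  exact: eigenvalue_le_spectral_radius (spectral_diag_eigenvalue i Hn).
move: (spectral_radius H) le_rho => rho le_rho.
move: (Hn) => /orthomx_spectralP.
set P := spectralmx H; set d := spectral_diag H.
have Pu : P \is unitarymx := spectral_unitarymx H.
rewrite invmx_unitary // => HE; set y := P *m v.
have vy : vnorm v = vnorm y.
  apply/eqP; rewrite -(@eqrXn2 _ 2) ?vnorm_ge0 //; apply/eqP/complexI.
  rewrite !vnorm_sqr /y trmxC_mul mulmxA -(mulmxA _ _ P).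
  by rewrite (mulmx1C (unitarymxP Pu)) mulmx1.
have -> : vnorm (M *m v) ^+ 2 = modulus ((v ^t* *m (H *m v)) 0 0).
  apply/esym; rewrite -[LHS](_ : modulus (vnorm (M *m v) ^+ 2)%:C = _).
    by rewrite modulus_real // exprn_ge0 // vnorm_ge0.
  by rewrite vnorm_sqr trmxC_mul /H !mulmxA.
rewrite vy vnorm_sqr_sum mulr_sumr HE !mulmxA -trmxC_mul -/y -(mulmxA _ P) -/y.
clearbody y; rewrite mxE; apply: le_trans (modulus_sum _ _ _) _.
apply: ler_sum => i _.
rewrite mul_mx_diag !mxE !modulusM.
have -> : modulus (Num.conj (y i 0)) = modulus (y i 0).
  by apply: complexI; rewrite -!modulus_normE norm_conjC.
by rewrite mulrAC -expr2 mulrC ler_wpM2r ?exprn_ge0 ?modulus_ge0.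
Qed.

Lemma spectral_norm_ge0 (R : realType) m (M : 'M[R[i]]_m) :
  0 <= spectral_norm M.
Proof. exact: sqrtr_ge0. Qed.

Lemma spectral_norm_gt0 (R : realType) m (M : 'M[R[i]]_m) :
  M != 0 -> 0 < spectral_norm M.
Proof.
move=> M0; rewrite lt_def spectral_norm_ge0 andbT.
apply: contraNneq M0 => Mn; apply/eqP/matrixP => i j; rewrite mxE.
have Mv : M *m delta_mx j 0 = 0 :> 'cV_m.
  apply/eqP; apply: contraT => /vnorm_gt0.
  by rewrite ltNge (le_trans (vnorm_mulmx _ _)) // Mn mul0r.
by have := congr1 (fun N : 'cV_m => N i 0) Mv; rewrite -colE !mxE.
Qed.

Lemma spectral_norm_inv_ge1 (R : realType) m (M N : 'M[R[i]]_m) : (0 < m)%N ->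
  M *m N = 1%:M -> 1 <= spectral_norm M * spectral_norm N.
Proof.
move=> m0 MN; pose v : 'cV[R[i]]_m := const_mx 1.
have v0 : 0 < vnorm v.
  apply: vnorm_gt0; apply/eqP => /matrixP /(_ (Ordinal m0) 0) /eqP.
  by rewrite !mxE oner_eq0.
rewrite -(ler_pM2r v0) mul1r -{1}[v]mul1mx -MN -!mulmxA -mulrA.
apply: le_trans (vnorm_mulmx _ _) _.
by rewrite ler_wpM2l ?spectral_norm_ge0 // vnorm_mulmx.
Qed.

(** * Root counts at a radius where Pellet's inequality holds *)

(** The right-hand side of the equation defining [pellet_solutions]. *)
Definition pellet_sum (R : realType) (m n : nat)
    (A : 'I_n.+1 -> 'M[R[i]]_m) (k : 'I_n.+1) (x : R) : R :=
  \sum_(i < n.+1 | i != k) spectral_norm (invmx (A k) *m A i) * x ^+ i.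

(** The family det (A_k x^k + c (A(x) - A_k x^k)), polynomial in c (the outer
indeterminate) with coefficients polynomial in x (the inner one). It joins
det (A_k) x^(k m) at c = 0 to det A(x) at c = 1. *)
Definition pellet_family (R : realType) (m n : nat)
    (A : 'I_n.+1 -> 'M[R[i]]_m) (k : 'I_n.+1) : {poly {poly R[i]}} :=
  \det (map_mx polyC ('X^k *: map_mx polyC (A k)) +
        'X *: map_mx polyC
          (\sum_(i < n.+1 | i != k) 'X^i *: map_mx polyC (A i))).

Lemma horner_det (S : comNzRingType) m (M : 'M[{poly S}]_m) (c : S) :
  (\det M).[c] = \det (map_mx (horner_eval c) M).
Proof. by rewrite det_map_mx. Qed.

Lemma pellet_familyE (R : realType) m n (A : 'I_n.+1 -> 'M[R[i]]_m) k c :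
  (pellet_family A k).[c] =
    \det ('X^k *: map_mx polyC (A k) +
          c *: \sum_(i < n.+1 | i != k) 'X^i *: map_mx polyC (A i)).
Proof.
rewrite /pellet_family horner_det; congr (\det _).
by apply/matrixP => i j; rewrite !mxE /horner_eval !hornerE.
Qed.

Lemma pellet_family1 (R : realType) m n (A : 'I_n.+1 -> 'M[R[i]]_m) k :
  (pellet_family A k).[1] = matpoly_det A.
Proof.
rewrite pellet_familyE scale1r; congr (\det _); apply/esym.
exact: (bigD1 k).
Qed.

Lemma pellet_family0 (R : realType) m n (A : 'I_n.+1 -> 'M[R[i]]_m) k :
  (pellet_family A k).[0] = \det (A k) *: 'X^(m * k).
Proof.
rewrite pellet_familyE scale0r addr0 detZ det_map_mx mulrC -mul_polyC.
by rewrite -exprM mulnC.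
Qed.

Lemma horner_pellet_family (R : realType) m n (A : 'I_n.+1 -> 'M[R[i]]_m)
    k c z :
  (pellet_family A k).[c%:P].[z] =
    \det (z ^+ k *: A k + c *: \sum_(i < n.+1 | i != k) z ^+ i *: A i).
Proof.
rewrite pellet_familyE horner_det; congr (\det _); apply/matrixP => a b.
rewrite !mxE /horner_eval !hornerE !summxE horner_sum; congr (_ + _ * _).
by apply: eq_bigr => i _; rewrite !mxE !hornerE.
Qed.

Lemma det0_cV (F : fieldType) m (M : 'M[F]_m) : \det M = 0 ->
  exists2 v : 'cV[F]_m, v != 0 & M *m v = 0.
Proof.
rewrite -det_tr => /eqP /det0P[u u0 uM]; exists u^T.
  by apply: contra_neq u0 => u0; rewrite -[u]trmxK u0 trmx0.
by rewrite -[M]trmxK -trmx_mul uM trmx0.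
Qed.

(** A null vector v of the matrix at z satisfies
z^k v = - t * sum_(i <> k) z^i A_k^-1 A_i v. *)
Lemma pellet_family_root (R : realType) m n (A : 'I_n.+1 -> 'M[R[i]]_m) k
    (t : R) z : \det (A k) != 0 -> 0 <= t ->
  root (pellet_family A k).[t%:C%:P] z ->
  modulus z ^+ k <= t * pellet_sum A k (modulus z).
Proof.
move=> Ak t0 /rootP; rewrite horner_pellet_family => /det0_cV[v v0 Mv].
have Aku : A k \in unitmx by rewrite unitmxE unitfE.
have vk : z ^+ k *: v = - (t%:C *: \sum_(i < n.+1 | i != k)
    z ^+ i *: (invmx (A k) *m A i *m v)).
  have := congr1 (mulmx (invmx (A k))) Mv.
  rewrite mulmx0 mulmxDl mulmxDr -!scalemxAl -!scalemxAr mulKmx // => /eqP.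
  rewrite addr_eq0 => /eqP ->; congr (- (_ *: _)).
  rewrite mulmx_suml mulmx_sumr; apply: eq_bigr => i _.
  by rewrite -scalemxAl -scalemxAr mulmxA.
rewrite -(ler_pM2r (vnorm_gt0 v0)) -modulusX -vnormZ vk -scaleNr vnormZ.
rewrite modulusN modulus_real // -mulrA ler_wpM2l //.
apply: le_trans (vnorm_sum _ _ _) _; rewrite mulr_suml; apply: ler_sum => i _.
rewrite vnormZ modulusX mulrC mulrAC ler_wpM2r ?exprn_ge0 ?modulus_ge0 //.
exact: vnorm_mulmx.
Qed.

Lemma pellet_root (R : realType) m n (A : 'I_n.+1 -> 'M[R[i]]_m) k z :
  \det (A k) != 0 -> root (matpoly_det A) z ->
  modulus z ^+ k <= pellet_sum A k (modulus z).
Proof.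
have E1 : (1 : R)%:C%:P = 1 :> {poly R[i]} by rewrite !rmorph1.
move=> Ak; rewrite -(pellet_family1 A k) -E1.
by move=> /(pellet_family_root Ak ler01); rewrite mul1r.
Qed.

Lemma nroots_lt_ZXn (R : realType) (c : R[i]) N (r : R) : c != 0 -> 0 < r ->
  nroots_lt (c *: 'X^N) r = N.
Proof.
move=> c0 r0; have p0 : c *: 'X^N != 0.
  by rewrite scaler_eq0 negb_or c0 monic_neq0 ?monicXn.
rewrite /nroots_lt (_ : count _ _ = size (roots_seq (c *: 'X^N))).
  by apply/succn_inj; rewrite size_roots_seq // size_scale // size_polyXn.
apply/eqP; rewrite -all_count; apply/allP => z; rewrite mem_roots_seq //.
rewrite rootZ // /root !hornerE expf_eq0 => /andP[_ /eqP ->].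
by rewrite modulus0.
Qed.

Lemma pellet_count (R : realType) m n (A : 'I_n.+1 -> 'M[R[i]]_m) k (x : R) :
  matpoly_det A != 0 -> \det (A k) != 0 ->
  0 < x -> pellet_sum A k x <= x ^+ k ->
  (nroots_lt (matpoly_det A) x <= m * k <= nroots_le (matpoly_det A) x)%N.
Proof.
move=> a0 Ak x0 dom.
have := @family_nroots R (pellet_family A k) x x0.
rewrite pellet_family0 pellet_family1 nroots_lt_ZXn //; apply=> // t w.
case/andP=> t0 t1 wx; apply/negP => /(pellet_family_root Ak t0); rewrite wx.
apply/negP; rewrite -ltNge.
apply: le_lt_trans (ler_wpM2l t0 dom) _.
by rewrite gtr_pMl ?exprn_gt0.
Qed.

(** * Solutions of Pellet's equation *)

(** By ||A_k^-1 A_j|| * ||A_j^-1 A_k|| >= 1, the number x^(k - j) is at most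
||A_k^-1 A_j||, and the latter is at most y^(k - j). *)
Lemma pellet_solutions_le (R : realType) m n (A : 'I_n.+1 -> 'M[R[i]]_m)
    (j k : 'I_n.+1) x y :
  (0 < m)%N -> (j < k)%N -> \det (A j) != 0 -> \det (A k) != 0 ->
  pellet_solutions A j x -> pellet_solutions A k y -> x <= y.
Proof.
move=> m0 jk Aj Ak.
have Aju : A j \in unitmx by rewrite unitmxE unitfE; exact: Aj.
have Aku : A k \in unitmx by rewrite unitmxE unitfE; exact: Ak.
move=> [x0 xE] [y0 yE].
have ujk : j != k by rewrite -(inj_eq val_inj) ltn_eqF.
have term_le (i l : 'I_n.+1) u : i != l -> 0 < u -> u ^+ l = pellet_sum A l u ->
    spectral_norm (invmx (A l) *m A i) * u ^+ i <= u ^+ l.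
  move=> il u0 ->; rewrite /pellet_sum (bigD1 i) //= lerDl.
  apply: sumr_ge0 => q _.
  by rewrite mulr_ge0 ?spectral_norm_ge0 // exprn_ge0 // ltW.
have := term_le k j x; rewrite eq_sym => /(_ ujk x0 xE).
have := term_le j k y ujk y0 yE.
have : 1 <= spectral_norm (invmx (A k) *m A j) *
            spectral_norm (invmx (A j) *m A k).
  apply: spectral_norm_inv_ge1 => //.
  by rewrite mulmxA (mulmxK Aju) (mulVmx Aku).
have := spectral_norm_ge0 (invmx (A k) *m A j).
move: (spectral_norm _) (spectral_norm _) => c c' c0 cc'.
rewrite -(subnK (ltnW jk)) !exprD ler_pM2r ?exprn_gt0 // => cy.
rewrite mulrA -{2}[x ^+ j]mul1r ler_pM2r ?exprn_gt0 // => cx.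
set d := (k - j)%N in cx cy *.
rewrite -(@ler_pXn2r _ d) ?nnegrE ?(ltW x0) ?(ltW y0) ?subn_gt0 //.
apply: le_trans cy.
rewrite -[leRHS]mulr1; apply: le_trans (ler_wpM2l c0 cx).
by rewrite mulrA ler_peMl // exprn_ge0 // ltW.
Qed.

(** * Radii strictly between two solutions *)

Lemma exprn_convex (R : realType) (s x t : R) d : 0 < s < x -> x < t ->
  (t - s) * x ^+ d <= (t - x) * s ^+ d + (x - s) * t ^+ d.
Proof.
move=> /andP[s0 sx] xt; have x0 := lt_trans s0 sx.
elim: d => [|d IH]; first by rewrite !expr0 !mulr1; lra.
rewrite !exprS.
have := ler_wpM2l (ltW x0) IH.
have : 0 <= (t - x) * (x - s) * (t ^+ d - s ^+ d).
  rewrite !mulr_ge0 ?subr_ge0 ?(ltW xt) ?(ltW sx) //.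
  rewrite lerXn2r ?nnegrE ?(ltW s0) ?(ltW (lt_trans x0 xt)) //.
  by rewrite ltW // (lt_trans sx).
nra.
Qed.

Lemma exprnV_convex (R : realType) (s x t : R) d : 0 < s < x -> x < t ->
  (t - s) * x^-1 ^+ d.+1 < (t - x) * s^-1 ^+ d.+1 + (x - s) * t^-1 ^+ d.+1.
Proof.
move=> /andP[s0 sx] xt; have x0 := lt_trans s0 sx; have t0 := lt_trans x0 xt.
have step e :
    (t - s) * x^-1 ^+ e <= (t - x) * s^-1 ^+ e + (x - s) * t^-1 ^+ e ->
    (t - s) * x^-1 ^+ e.+1 < (t - x) * s^-1 ^+ e.+1 + (x - s) * t^-1 ^+ e.+1.
  move=> IH; rewrite ![_ ^+ e.+1]exprS.
  have xV0 : 0 < x^-1 by rewrite invr_gt0.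
  apply: le_lt_trans
    (_ : x^-1 * ((t - x) * s^-1 ^+ e + (x - s) * t^-1 ^+ e) < _).
    by rewrite mulrCA ler_pM2l.
  have pos :
      0 < (t - x) * (x - s) * x^-1 * (s^-1 * s^-1 ^+ e - t^-1 * t^-1 ^+ e).
    rewrite !mulr_gt0 ?subr_gt0 // -!exprS.
    rewrite ltrXn2r ?invr_ge0 ?(ltW t0) ?(ltW s0) //.
    by rewrite ltf_pV2 ?posrE // (lt_trans sx).
  rewrite -subr_gt0; apply: lt_le_trans pos _.
  rewrite le_eqVlt; apply/orP; left; apply/eqP.
  move: (s^-1 ^+ e) (t^-1 ^+ e) => S T.
  by field; rewrite !gt_eqF.
by elim: d => [|d /ltW IH]; apply: step => //; rewrite !expr0 !mulr1; lra.
Qed.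

Lemma sum_ltr_ex (R : realType) (I : finType) (P : pred I) (F G : I -> R)
    (j : I) :
  P j -> F j < G j -> (forall i, P i -> F i <= G i) ->
  \sum_(i | P i) F i < \sum_(i | P i) G i.
Proof.
move=> Pj FGj FG; rewrite (bigD1 j) // [ltRHS](bigD1 j) //=.
by apply: ltr_leD => //; apply: ler_sum => i /andP[/FG].
Qed.

(** The coefficients c_i stand for ||A_k^-1 A_i||, so that f is [pellet_sum]. *)
Section Dominance.

Variables (R : realType) (n : nat) (k : 'I_n.+1) (c : 'I_n.+1 -> R).
Hypothesis c_ge0 : forall i, 0 <= c i.
Local Notation f x := (\sum_(i < n.+1 | i != k) c i * x ^+ i).

(** After division by x^k, the strict convexity of x^(i - k) for i = 0 < k gives
the strict inequality. *)
Lemma dominance_between s x t : k != ord0 -> 0 < c ord0 -> 0 < s < x -> x < t ->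
  s ^+ k = f s -> t ^+ k = f t -> f x < x ^+ k.
Proof.
move=> k0 c0 sx xt sE tE; have /andP[s0 lt_sx] := sx.
have x0 := lt_trans s0 lt_sx; have t0 := lt_trans x0 xt.
pose w (u : R) (i : 'I_n.+1) := u ^+ i / u ^+ k.
have wE u : 0 < u -> f u / u ^+ k = \sum_(i < n.+1 | i != k) c i * w u i.
  by move=> u0; rewrite mulr_suml; apply: eq_bigr => i _; rewrite mulrA.
have ts0 : 0 < t - s by rewrite subr_gt0 (lt_trans lt_sx).
have w_lt (i : 'I_n.+1) : (i < k)%N ->
    (t - s) * w x i < (t - x) * w s i + (x - s) * w t i.
  move=> ik; have wV u : 0 < u -> w u i = u^-1 ^+ (k - i.+1).+1.
    by move=> u0; rewrite subnSK // exprVn expfB // invf_div.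
  by rewrite !wV //; apply: exprnV_convex.
have w_le (i : 'I_n.+1) : (t - s) * w x i <= (t - x) * w s i + (x - s) * w t i.
  have [ki|/w_lt/ltW//] := leqP k i.
  have wV u : 0 < u -> w u i = u ^+ (i - k).
    by move=> u0; rewrite expfB_cond // gt_eqF.
  by rewrite !wV //; apply: exprn_convex.
rewrite -[ltRHS]mul1r -ltr_pdivrMr ?exprn_gt0 // wE // -(ltr_pM2l ts0).
apply: (@lt_le_trans _ _ (\sum_(i < n.+1 | i != k)
    c i * ((t - x) * w s i + (x - s) * w t i))).
  rewrite mulr_sumr.
  apply: (@sum_ltr_ex _ _ _ _ _ ord0); first by rewrite eq_sym.
    rewrite mulrCA ltr_pM2l // w_lt // lt0n.
    by apply: contra k0 => /eqP k0; apply/eqP/val_inj.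
  by move=> i _; rewrite mulrCA ler_wpM2l.
have -> : \sum_(i < n.+1 | i != k) c i * ((t - x) * w s i + (x - s) * w t i) =
    (t - x) * (f s / s ^+ k) + (x - s) * (f t / t ^+ k).
  rewrite !wE // !mulr_sumr -big_split; apply: eq_bigr => i _.
  by rewrite mulrDr; congr (_ + _); apply: mulrCA.
rewrite -sE -tE !divff ?expf_neq0 ?gt_eqF //.
lra.
Qed.

Lemma dominance_below x t :
  k = ord0 -> 0 < c ord_max -> (0 < n)%N -> 0 < x < t ->
  t ^+ k = f t -> f x < x ^+ k.
Proof.
move=> -> cn n0 /andP[x0 xt] tE; rewrite expr0.
move: tE; rewrite expr0 => ->; have t0 := lt_trans x0 xt.
apply: (@sum_ltr_ex _ _ _ _ _ ord_max).
- by rewrite -(inj_eq val_inj) /= gt_eqF.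
- by rewrite ltr_pM2l // ltrXn2r ?(ltW x0) ?(ltW t0) //= -lt0n n0.
- move=> i _; rewrite ler_wpM2l // lerXn2r ?nnegrE ?(ltW x0) ?(ltW t0) //.
  exact: ltW.
Qed.

(** Here x^i / x^n is nonincreasing in x, and strictly decreasing for i = 0. *)
Lemma dominance_above s x :
  k = ord_max -> 0 < c ord0 -> (0 < n)%N -> 0 < s < x ->
  s ^+ k = f s -> f x < x ^+ k.
Proof.
move=> kE c0 n0 /andP[s0 sx] sE; have x0 := lt_trans s0 sx.
have term (i : 'I_n.+1) : x ^+ i * s ^+ k = s ^+ i * x ^+ i * s ^+ (k - i) /\
    s ^+ i * x ^+ k = s ^+ i * x ^+ i * x ^+ (k - i).
  have ik : (i <= k)%N by rewrite kE -ltnS.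
  by rewrite -!mulrA -!exprD subnKC // mulrCA -exprD subnKC.
rewrite -(ltr_pM2r (exprn_gt0 k s0)) [ltRHS]mulrC {2}sE !mulr_suml.
have sx0 (i : 'I_n.+1) : 0 < s ^+ i * x ^+ i by rewrite mulr_gt0 ?exprn_gt0.
apply: (@sum_ltr_ex _ _ _ _ _ ord0).
- by rewrite kE -(inj_eq val_inj) /= lt_eqF.
- rewrite -!mulrA ltr_pM2l //; have [-> ->] := term ord0.
  by rewrite ltr_pM2l // ltrXn2r ?(ltW s0) ?(ltW x0) // subn0 kE -lt0n.
move=> i _; rewrite -!mulrA ler_wpM2l //; have [-> ->] := term i.
by rewrite ler_pM2l // lerXn2r ?nnegrE ?(ltW s0) ?(ltW x0) ?(ltW sx).
Qed.

End Dominance.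

Lemma real_roots_finite (R : realType) (q : {poly R}) : q != 0 ->
  exists l : seq R, forall x, root q x -> x \in l.
Proof.
pose qC := map_poly (real_complex R) q.
move=> q0; exists (map (@complex.Re R) (roots_seq qC)) => x qx.
apply/mapP; exists x%:C => //.
by rewrite mem_roots_seq ?map_poly_eq0 // fmorph_root.
Qed.

Lemma finite_extremum (T : eqType) (r : rel T) (S : set T) (l : seq T) :
  reflexive r -> total r -> transitive r ->
  (exists2 x, x \in l & S x) ->
  exists2 y, S y & forall x, x \in l -> S x -> r x y.
Proof.
move=> rr rt rtr; elim: l => [[x]//|a l IH] [x xl Sx].
have [/IH[y Sy ly]|nl] := pselect (exists2 x, x \in l & S x); last first.
  have xS z : z \in a :: l -> S z -> z = a.
    by rewrite inE => /predU1P[//|zl Sz]; case: nl; exists z.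
  by exists a => [|z /xS/[apply]->//]; rewrite -(xS x xl Sx).
have [Sa|nSa] := pselect (S a); last first.
  by exists y => // z; rewrite inE => /predU1P[->//|]; apply: ly.
have /orP[ay|ya] := rt a y.
  by exists y => // z; rewrite inE => /predU1P[->//|]; apply: ly.
exists a => // z; rewrite inE => /predU1P[->//|zl Sz].
exact: rtr (ly z zl Sz) ya.
Qed.

Lemma finite_inf_sup (R : realType) (S : set R) (l : seq R) :
  (forall x, S x -> x \in l) -> (exists x, S x) ->
  [/\ S (inf S), S (sup S) & forall x, S x -> inf S <= x <= sup S].
Proof.
move=> Sl [x0 Sx0].
have Sex : exists2 x, x \in l & S x by exists x0 => //; apply: Sl.
have Sn0 : (S !=set0)%classic by exists x0.
have [M SM leM] := finite_extremum (@le_refl _ R) (@le_total _ R)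
  (@le_trans _ R) Sex.
have [N SN leN] := @finite_extremum _ >=%O S l (@ge_refl _ R)
  (fun x y => le_total y x) (@ge_trans _ R) Sex.
have hM : forall x, S x -> x <= M by move=> x Sx; apply: leM => //; apply: Sl.
have hN : forall x, S x -> N <= x by move=> x Sx; apply: leN => //; apply: Sl.
have -> : sup S = M.
  by apply/le_anti; rewrite ge_sup // ub_le_sup //; exists M.
have -> : inf S = N.
  by apply/le_anti; rewrite lb_le_inf // ge_inf //; exists N.
by split=> // x Sx; rewrite hM // hN.
Qed.

(** The solutions are roots of a nonzero polynomial, so they are finitely many,
and their infimum and supremum are solutions. *)
Lemma pellet_solutions_extrema (R : realType) m n
    (A : 'I_n.+1 -> 'M[R[i]]_m) k :
  (exists x, pellet_solutions A k x) ->
  [/\ pellet_solutions A k (inf (pellet_solutions A k)),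
      pellet_solutions A k (sup (pellet_solutions A k))
    & forall x, pellet_solutions A k x ->
        inf (pellet_solutions A k) <= x <= sup (pellet_solutions A k)].
Proof.
pose q : {poly R} := 'X^k -
  \sum_(i < n.+1 | i != k) spectral_norm (invmx (A k) *m A i) *: 'X^i.
have q0 : q != 0.
  apply/eqP => /(congr1 (fun p : {poly R} => p`_k)).
  rewrite coefB coefXn eqxx coef_sum big1 => [|i ik].
    by rewrite subr0 coef0 => /eqP; rewrite oner_eq0.
  by rewrite coefZ coefXn eq_sym (inj_eq val_inj) (negPf ik) mulr0.
have [l ql] := real_roots_finite q0; apply: (@finite_inf_sup _ _ l) => x [_ xE].
apply: ql; rewrite /root /q hornerD hornerN hornerXn horner_sum xE subr_eq0.
by apply/eqP/eq_bigr => i _; rewrite hornerZ hornerXn.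
Qed.

(** For n = 0 the equation reads 1 = 0. *)
Lemma pellet_solutions_n_gt0 (R : realType) m n
    (A : 'I_n.+1 -> 'M[R[i]]_m) k x :
  pellet_solutions A k x -> (0 < n)%N.
Proof.
case: n A k => // A k [x0]; rewrite big1 => [/eqP|i].
  by rewrite expf_eq0 gt_eqF // andbF.
by rewrite (ord1 i) (ord1 k) eqxx.
Qed.

Lemma invmx_mul_norm_gt0 (R : realType) m (M N : 'M[R[i]]_m) :
  \det M != 0 -> N != 0 -> 0 < spectral_norm (invmx M *m N).
Proof.
move=> M0 N0; apply: spectral_norm_gt0; apply: contra_neq N0 => MN.
have Mu : M \in unitmx by rewrite unitmxE unitfE.
by rewrite -(mulKVmx Mu N) MN mulmx0.
Qed.

(** No root of det A lies strictly between s_k and t_k. *)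
Lemma pellet_root_free (R : realType) m n (A : 'I_n.+1 -> 'M[R[i]]_m) k z :
  in_Pmn A -> pellet_index A k -> root (matpoly_det A) z ->
  z \notin annulus_inner (pellet_s A k) (pellet_t A k).
Proof.
case=> _ An A0 [Ak Sex] az.
have [sS tS _] := pellet_solutions_extrema Sex.
have n0 := pellet_solutions_n_gt0 sS.
have := pellet_root Ak az; apply: contraTN; rewrite inE -ltNge.
have c0 i : 0 <= spectral_norm (invmx (A k) *m A i) by apply: spectral_norm_ge0.
have [k_max|k_nmax] := eqVneq k ord_max.
  have k_n0 : k != ord0 by rewrite k_max -(inj_eq val_inj) /= gt_eqF.
  rewrite /pellet_s (negPf k_n0) lte_fin => /andP[sz _].
  apply: (dominance_above c0 k_max (invmx_mul_norm_gt0 Ak A0) n0 _ sS.2).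
  by rewrite sS.1.
rewrite /pellet_s /pellet_t (negPf k_nmax); have [k_0|k_n0] := eqVneq k ord0.
  rewrite !lte_fin => zt.
  exact: (dominance_below c0 k_0 (invmx_mul_norm_gt0 Ak An) n0 zt tS.2).
rewrite !lte_fin => /andP[sz zt].
apply: (dominance_between c0 k_n0 (invmx_mul_norm_gt0 Ak A0) _ zt sS.2 tS.2).
by rewrite sS.1.
Qed.

(** * Root counts at s_k and t_k *)

Lemma pellet_solution_count (R : realType) m n (A : 'I_n.+1 -> 'M[R[i]]_m) k x :
  matpoly_det A != 0 -> \det (A k) != 0 -> pellet_solutions A k x ->
  (nroots_lt (matpoly_det A) x <= m * k <= nroots_le (matpoly_det A) x)%N.
Proof.
by move=> a0 Ak [x0 xE]; apply: pellet_count => //; rewrite xE /pellet_sum lexx.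
Qed.

(** If s_k = t_k, no root of det A(x) has this modulus. *)
Definition pellet_circle_free (R : realType) m n (A : 'I_n.+1 -> 'M[R[i]]_m)
    (k : 'I_n.+1) : Prop :=
  pellet_s A k = pellet_t A k ->
  forall z : R[i], root (matpoly_det A) z -> (modulus z)%:E <> pellet_s A k.

Lemma nroots_le_lt_leq (R : realType) (p : {poly R[i]}) (x y : R) : x < y ->
  (nroots_le p x <= nroots_lt p y)%N.
Proof. by move=> xy; apply: sub_count => z /= zx; apply: le_lt_trans xy. Qed.

(** There are at most m k roots of modulus less than t_k, and exactly m k if no
root lies in a degenerate annulus s_k = t_k. *)
Lemma nroots_lt_pellet_t (R : realType) m n (A : 'I_n.+1 -> 'M[R[i]]_m) k :
  in_Pmn A -> pellet_index A k -> k != ord_max ->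
  (nroots_lt (matpoly_det A) (sup (pellet_solutions A k)) <= m * k)%N /\
  (pellet_circle_free A k ->
     (m * k <= nroots_lt (matpoly_det A) (sup (pellet_solutions A k)))%N).
Proof.
case=> a0 An A0 [Ak Sex] k_nmax.
have [sS tS hst] := pellet_solutions_extrema Sex.
have /andP[le_t _] := pellet_solution_count a0 Ak tS.
have /andP[_ ge_s] := pellet_solution_count a0 Ak sS.
split=> // free.
have [k_0|k_n0] := eqVneq k ord0; first by rewrite k_0 muln0.
have /andP[_ st] := hst _ sS.
move: st; rewrite le_eqVlt => /predU1P[st|st]; last first.
  exact: leq_trans ge_s (nroots_le_lt_leq _ st).
rewrite -st -nroots_le_lt // => w wr; apply/negP => aw.
move: free; rewrite /pellet_circle_free /pellet_s /pellet_t.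
rewrite (negPf k_n0) (negPf k_nmax).
by rewrite st => /(_ erefl w aw); apply; rewrite wr st.
Qed.

(** There are at least m k roots of modulus at most s_k, and exactly m k if no
root lies in a degenerate annulus s_k = t_k. *)
Lemma nroots_le_pellet_s (R : realType) m n (A : 'I_n.+1 -> 'M[R[i]]_m) k :
  in_Pmn A -> pellet_index A k -> k != ord0 ->
  (m * k <= nroots_le (matpoly_det A) (inf (pellet_solutions A k)))%N /\
  (pellet_circle_free A k ->
     (nroots_le (matpoly_det A) (inf (pellet_solutions A k)) <= m * k)%N).
Proof.
case=> a0 An A0 [Ak Sex] k_n0.
have [sS tS hst] := pellet_solutions_extrema Sex; have [s0 sE] := sS.
have n0 := pellet_solutions_n_gt0 sS.
have /andP[le_t _] := pellet_solution_count a0 Ak tS.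
have /andP[le_s ge_s] := pellet_solution_count a0 Ak sS.
split=> // free.
have [k_max|k_nmax] := eqVneq k ord_max.
  (* As t_n is infinite, s + 1 serves as a radius beyond s = s_n. *)
  set s := inf _ in s0 sE *; have s1 : s < s + 1 by rewrite ltrDl.
  apply: leq_trans (nroots_le_lt_leq _ s1) _.
  have dom : pellet_sum A k (s + 1) <= (s + 1) ^+ k.
    apply: ltW.
    apply: (dominance_above _ k_max (invmx_mul_norm_gt0 Ak A0) n0 _ sE).
      by move=> i; apply: spectral_norm_ge0.
    by rewrite s0.
  by have /andP[] := pellet_count a0 Ak (lt_trans s0 s1) dom.
have /andP[_ st] := hst _ sS.
move: st; rewrite le_eqVlt => /predU1P[st|st]; last first.
  exact: leq_trans (nroots_le_lt_leq _ st) le_t.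
rewrite nroots_le_lt // => w wr; apply/negP => aw.
move: free; rewrite /pellet_circle_free /pellet_s /pellet_t.
rewrite (negPf k_n0) (negPf k_nmax).
by rewrite -st => /(_ erefl w aw); apply; rewrite wr.
Qed.

Lemma nroots_in_annulus (R : realType) (p : {poly R[i]}) (x y : R) : x <= y ->
  (nroots_in p (annulus x%:E y%:E) + nroots_lt p x = nroots_le p y)%N.
Proof.
move=> xy; rewrite /nroots_in /nroots_lt /nroots_le -/(roots_seq p).
elim: (roots_seq p) => //= z s <-; rewrite addnACA; congr (_ + _)%N.
have -> : annulus x%:E y%:E z = (x <= modulus z <= y).
  by rewrite /annulus /= !lee_fin.
have [_|zx] := leP x (modulus z); first by rewrite addn0.
by rewrite (ltW (lt_le_trans zx xy)).
Qed.

Theorem corollary2p2 (R : realType) (m n : nat)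
    (A : 'I_n.+1 -> 'M[R[i]]_m) (HA : in_Pmn A)
    (p : nat) (h : nat -> 'I_n.+1)
    (h_incr : forall i j : nat, (i < j <= p)%N -> (h i < h j)%N)
    (h_val : forall k : 'I_n.+1,
        pellet_index A k <-> exists2 i : nat, (i <= p)%N & h i = k) :
  [/\ (forall i : nat, (1 <= i <= p)%N ->
         (pellet_t A (h i.-1) <= pellet_s A (h i))%E),
      (forall i : nat, (1 <= i <= p)%N ->
         (m * (h i - h i.-1) <= nroots_in (matpoly_det A)
              (annulus (pellet_t A (h i.-1)) (pellet_s A (h i))))%N
         /\
         ((forall k : 'I_n.+1, k = h i.-1 \/ k = h i ->
             pellet_s A k = pellet_t A k ->
             forall z : R[i], root (matpoly_det A) z ->
               (modulus z)%:E <> pellet_s A k) ->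
          nroots_in (matpoly_det A)
            (annulus (pellet_t A (h i.-1)) (pellet_s A (h i)))
          = (m * (h i - h i.-1))%N))
    & (forall i : nat, (i <= p)%N ->
         forall z : R[i], root (matpoly_det A) z ->
           z \notin annulus_inner (pellet_s A (h i)) (pellet_t A (h i)))].
Proof.
have m0 : (0 < m)%N.
  (* A 0 x 0 matrix is zero, which A_n is not. *)
  case: m A HA {h_val} => // A [_ /eqP[]].
  by apply/matrixP => -[].
have idx i : (i <= p)%N -> pellet_index A (h i).
  by move=> ip; apply/h_val; exists i.
have consec i : (1 <= i <= p)%N ->
    [/\ pellet_index A (h i.-1), pellet_index A (h i), (h i.-1 < h i)%N,
        h i.-1 != ord_max & h i != ord0].
  case: i => // i /= ip.
  have lt_h : (h i < h i.+1)%N by rewrite h_incr // ltnSn.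
  split=> //; [exact/idx/ltnW|exact: idx| |].
    by rewrite -(inj_eq val_inj) /= neq_ltn (leq_trans lt_h) // -ltnS.
  by rewrite -(inj_eq val_inj) /= -lt0n (leq_ltn_trans _ lt_h).
have le_ts i : (1 <= i <= p)%N ->
    sup (pellet_solutions A (h i.-1)) <= inf (pellet_solutions A (h i)).
  move=> /consec[[Aj Sj] [Ak Sk] jk _ _].
  have [_ tS _] := pellet_solutions_extrema Sj.
  have [sS _ _] := pellet_solutions_extrema Sk.
  exact: pellet_solutions_le m0 jk Aj Ak tS sS.
split=> [i ip|i ip|i ip z az]; last exact: pellet_root_free (idx i ip) az.
  have [_ _ _ j_nmax k_n0] := consec i ip.
  by rewrite /pellet_t /pellet_s (negPf j_nmax) (negPf k_n0) lee_fin le_ts.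
have [Ij Ik jk j_nmax k_n0] := consec i ip.
have [lt_j ge_j] := nroots_lt_pellet_t HA Ij j_nmax.
have [le_k ge_k] := nroots_le_pellet_s HA Ik k_n0.
have := nroots_in_annulus (matpoly_det A) (le_ts i ip).
have -> : pellet_t A (h i.-1) = (sup (pellet_solutions A (h i.-1)))%:E.
  by rewrite /pellet_t (negPf j_nmax).
have -> : pellet_s A (h i) = (inf (pellet_solutions A (h i)))%:E.
  by rewrite /pellet_s (negPf k_n0).
move=> cnt; rewrite mulnBr; split=> [|free].
  rewrite leq_subLR addnC; apply: leq_trans le_k _.
  by rewrite -cnt leq_add2l.
have ge_j' := ge_j (free _ (or_introl erefl)).
have ge_k' := ge_k (free _ (or_intror erefl)).
have -> : (m * h i)%N =
    nroots_le (matpoly_det A) (inf (pellet_solutions A (h i))).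
  by apply/eqP; rewrite eqn_leq le_k.
have -> : (m * h i.-1)%N =
    nroots_lt (matpoly_det A) (sup (pellet_solutions A (h i.-1))).
  by apply/eqP; rewrite eqn_leq ge_j'.
by rewrite -cnt addnK.
Qed.
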